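(* For every integer $n\geq 3$, the diameter of the flip graph $\mathcal{G}_n$ is at least $\frac{7n}{3}-34$.
   Context: A triangulation means a simple combinatorial triangulation: a maximal planar graph without self-loops or multiple edges, together with a fixed clockwise rotation of the edges around each vertex (equivalently, an equivalence class of crossing-free drawings on the sphere of a maximal planar graph); all faces are triangles. Two triangulations are considered the same if they are isomorphic as combinatorial triangulations. Flipping an edge $(a,b)$ of a triangulation $G$: removing $(a,b)$ leaves a unique quadrilateral face bounded by a cycle $(a,a',b,b')$; the flip replaces $(a,b)$ by $(a',b')$ drawn inside this face. Only flips whose result is again simple (no multiple edges) are allowed. The flip graph $\mathcal{G}_n$ has as vertex set the distinct (pairwise non-isomorphic) $n$-vertex triangulations, and two triangulations $G,H$ are adjacent if flipping a single edge of $G$ yields (a triangulation isomorphic to) $H$. The diameter is the maximum, over all pairs of vertices of $\mathcal{G}_n$, of the length of a shortest path between them. *)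

(* Defs.v *)
From mathcomp Require Import all_boot all_fingroup.
Set Implicit Arguments. Unset Strict Implicit. Unset Printing Implicit Defensive.

(* A rotation system on vertex set 'I_n: a simple graph [adj] together with,
   for each vertex u, a permutation [rot u] of 'I_n that cyclically orders the
   neighbours of u (clockwise "next neighbour") and fixes all non-neighbours. *)

Definition darts_of n (adj : rel 'I_n) : {set 'I_n * 'I_n} :=
  [set p | adj p.1 p.2].

Definition face_step n (rot : 'I_n -> {perm 'I_n}) (p : 'I_n * 'I_n) :
  'I_n * 'I_n := (p.2, rot p.2 p.1).

Record triangulation (n : nat) := Triangulation {
  tadj : rel 'I_n;
  trot : 'I_n -> {perm 'I_n};
  tadj_irr : forall u, ~~ tadj u u;
  tadj_sym : forall u v, tadj u v = tadj v u;
  trot_out : forall u v, ~~ tadj u v -> trot u v = v;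
  trot_cyc : forall u v w, tadj u v -> tadj u w -> fconnect (trot u) v w;
  tconn : forall u v, connect tadj u v;
  tfaces3 : forall u v, tadj u v -> trot (trot v u) v = u;
  (* spherical (genus 0): Euler's formula V - E + F = 2 *)
  teuler : n + fcard (face_step trot) (darts_of tadj)
           = #|darts_of tadj| %/ 2 + 2
}.

Definition tri_iso n (G H : triangulation n) : Prop :=
  exists f : {perm 'I_n}, forall u v,
    tadj H (f u) (f v) = tadj G u v /\ trot H (f u) (f v) = f (trot G u v).

(* rotation after flipping edge ab of G; c = rot b a, d = rot a b are the
   apices of the two triangles (a,b,c), (b,a,d) incident to ab. *)
Definition flipped_rot n (G : triangulation n) (a b : 'I_n) (u v : 'I_n) : 'I_n :=
  let c := trot G b a in let d := trot G a b in
  if u == a then (if v == c then d else if v == b then b else trot G a v)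
  else if u == b then (if v == d then c else if v == a then a else trot G b v)
  else if u == c then (if v == b then d else if v == d then a else trot G c v)
  else if u == d then (if v == a then c else if v == c then b else trot G d v)
  else trot G u v.

(* H is the result of flipping edge (a,b) of G; the flip is allowed only when
   the result is simple (c <> d and cd is not already an edge). *)
Definition flip n (G : triangulation n) (a b : 'I_n) (H : triangulation n) : Prop :=
  let c := trot G b a in let d := trot G a b in
  [/\ tadj G a b, c != d, ~~ tadj G c d,
      forall u v, tadj H u v =
        (tadj G u v && ~~ (((u == a) && (v == b)) || ((u == b) && (v == a))))
        || ((u == c) && (v == d)) || ((u == d) && (v == c))
    & forall u v, trot H u v = flipped_rot G a b u v].

Definition flip_step n (G H : triangulation n) : Prop :=
  exists a b (H' : triangulation n), flip G a b H' /\ tri_iso H' H.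

Fixpoint flip_walk n (k : nat) (G H : triangulation n) : Prop :=
  match k with
  | 0 => tri_iso G H
  | k'.+1 => exists G' : triangulation n, flip_walk k' G G' /\ flip_step G' H
  end.

(* Main.v *)
(** A flip changes one edge, so for some bijection of the vertices the number of
    flips from [G] to [H] is at least the number of edges of [G] missing in [H].
    Take for [H] two adjacent vertices [x], [y] joined to all vertices of a path.
    Take for [G] a triangulation of maximum degree 6 on about [n/3] vertices with
    a new vertex stacked in each face: its maximum degree is 12 and the stacked
    vertices are independent.  At most 24 edges of [G] are sent to edges at [x] or
    [y]; the other common edges lie on the path and each has an unstacked endpoint,
    so there are at most [2n/3 + O(1)] of them among the [3n - 6] edges of [G].

    Both triangulations arise from a triangle by stacking vertices in faces.  The
    degree 6 triangulation is the cube of a path: each vertex is stacked in the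
    face formed by the previous three. When all faces are triangles, Euler's formula
    amounts to having [6n - 12] darts, which stacking preserves. *)
Require Import Defs.
From mathcomp Require Import all_boot all_fingroup.
From mathcomp Require Import zify.

Set Implicit Arguments. Unset Strict Implicit. Unset Printing Implicit Defensive.

(** * Darts, faces and Euler's formula in a rotation system *)

Section RotationSystem.

Variables (n : nat) (adj : rel 'I_n) (rot : 'I_n -> {perm 'I_n}).
Hypothesis adj_irr : forall u, ~~ adj u u.
Hypothesis rot_out : forall u v, ~~ adj u v -> rot u v = v.
Hypothesis faces3 : forall u v, adj u v -> rot (rot v u) v = u.

Lemma card_darts : #|darts_of adj| = \sum_u \sum_v adj u v.
Proof.
rewrite pair_bigA /= -sum1_card big_mkcond /=; apply: eq_bigr => p _.
by rewrite inE; case: (adj _ _).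
Qed.

(** [rot v] fixes every non-neighbour of [v], so by injectivity it also preserves the set of
    neighbours. *)
Lemma adj_rot u v : adj v (rot v u) = adj v u.
Proof.
apply/idP/idP; apply: contraTT => nadj; first by rewrite rot_out.
have /perm_inj e := rot_out nadj.
by rewrite -e.
Qed.

Lemma face_step_inj : injective (face_step rot).
Proof. by move=> [a b] [c d] [/= -> /perm_inj ->]. Qed.

(** Every orbit of [face_step] on darts is a 3-cycle (u,v), (v,w), (w,u), whose members are distinct
    since there are no loops. *)
Lemma card_faces : (forall u v, adj u v = adj v u) ->
  fcard (face_step rot) (darts_of adj) * 3 = #|darts_of adj|.
Proof.
move=> adj_sym.
have adj_next u v : adj v (rot v u) = adj u v by rewrite adj_rot adj_sym.
apply: (fcard_order_set face_step_inj).
  apply/subsetP => -[u v]; rewrite !inE /= => uv.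
  pose w := rot v u.
  have vw : adj v w by rewrite adj_next.
  have wu : rot w v = u by apply: faces3.
  have uw : rot u w = v by rewrite -wu faces3.
  rewrite (@order_cycle _ _ [:: (u, v); (v, w); (w, u)]) ?inE ?eqxx //=.
    by rewrite /face_step /= wu uw !eqxx.
  have nuv : u != v by apply: contraTneq uv => ->.
  have nvw : v != w by apply: contraTneq vw => ->.
  by rewrite !inE !xpair_eqE (eq_sym v u) (negPf nuv) (negPf nvw) !andbF.
by move=> [u v] [u' v'] /eqP[<- <-]; rewrite !inE /= adj_next.
Qed.

(** With D darts there are D/3 faces, and n + D/3 = D/2 + 2 rearranges to D + 12 = 6n. Reversal
    pairs the darts, so D is even and the truncated division is exact. *)
Lemma euler_card : (forall u v, adj u v = adj v u) ->
  n + fcard (face_step rot) (darts_of adj) = #|darts_of adj| %/ 2 + 2 <->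
  #|darts_of adj| + 12 = 6 * n.
Proof.
move=> adj_sym; have := card_faces adj_sym.
have : ~~ odd #|darts_of adj|.
  rewrite card_darts pair_bigA /=.
  rewrite (bigID (fun p : 'I_n * 'I_n => p.1 < p.2)) /=.
  have -> : \sum_(p : 'I_n * 'I_n | ~~ (p.1 < p.2)) adj p.1 p.2
          = \sum_(p : 'I_n * 'I_n | p.1 < p.2) adj p.1 p.2.
    rewrite (reindex_inj (h := fun p : 'I_n * 'I_n => (p.2, p.1))) /=; last first.
      by move=> [a b] [c d] [-> ->].
    rewrite [RHS]big_mkcond [LHS]big_mkcond; apply: eq_bigr => -[a b] _ /=.
    rewrite adj_sym -leqNgt; case: ltngtP => // /val_inj ->.
    by rewrite (negPf (adj_irr _)).
  by rewrite addnn odd_double.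
lia.
Qed.

End RotationSystem.

(** * Degrees and oriented faces *)

Definition deg n (T : triangulation n) u := \sum_v tadj T u v.

Lemma sum_deg n (T : triangulation n) : \sum_u deg T u + 12 = 6 * n.
Proof.
rewrite -card_darts; apply/(euler_card (@tadj_irr _ T)); last exact: teuler.
- exact: trot_out.
- exact: tfaces3.
- exact: tadj_sym.
Qed.

Definition face n (T : triangulation n) a b c := tadj T a b && (trot T b a == c).

Section Face.

Variables (n : nat) (T : triangulation n) (a b c : 'I_n).
Hypothesis abc : face T a b c.

Lemma face_adj : tadj T a b. Proof. by case/andP: abc. Qed.

Lemma face_rot : trot T b a = c. Proof. by case/andP: abc => _ /eqP. Qed.

Lemma face_rotate : face T b c a.
Proof.
rewrite /face -{1}face_rot (adj_rot (@trot_out _ T)) tadj_sym face_adj /=.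
by rewrite -face_rot tfaces3 ?face_adj.
Qed.

Lemma face_neq : a != b.
Proof. by apply: contraTneq face_adj => ->; rewrite tadj_irr. Qed.

End Face.


(** * Stacking a new vertex in a face *)

Section Stack.

Variables (n : nat) (T : triangulation n) (a b c : 'I_n).
Hypothesis abc : face T a b c.

Local Notation l := (lift ord0).
Local Notation z := (@ord0 n).

Let bca : face T b c a. Proof. exact: face_rotate. Qed.
Let cab : face T c a b. Proof. exact: face_rotate. Qed.
Let nab : (a == b) = false. Proof. exact/negbTE/(face_neq abc). Qed.
Let nbc : (b == c) = false. Proof. exact/negbTE/(face_neq bca). Qed.
Let nca : (c == a) = false. Proof. exact/negbTE/(face_neq cab). Qed.
Let nba : (b == a) = false. Proof. by rewrite eq_sym. Qed.
Let ncb : (c == b) = false. Proof. by rewrite eq_sym. Qed.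

Let corner u := [|| u == a, u == b | u == c].

Let cornerP u : reflect [\/ u = a, u = b | u = c] (corner u).
Proof.
apply: (iffP or3P) => [] [];
  by [move/eqP=> ->; constructor | move=> ->; constructor; apply/eqP].
Qed.

(** The new vertex is [ord0]; the old ones are shifted by [lift ord0]. *)
Definition stack_adj (u v : 'I_n.+1) :=
  match unlift z u, unlift z v with
  | Some u', Some v' => tadj T u' v'
  | Some u', None | None, Some u' => corner u'
  | None, None => false
  end.

(* The neighbour of [u] after which the new vertex is inserted; off the face it
   is the new vertex itself, so that the transposition in [stack_rot] is trivial. *)
Definition stack_pre u : 'I_n.+1 :=
  if u == a then l c else if u == b then l a else if u == c then l b else z.

(** The left factor of a product acts first. At a corner, the transposition inserts the new vertex
    between [stack_pre] and its old successor; at the new vertex the corners are turned [a] to [c]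
    to [b] to [a]. *)
Definition stack_rot (u : 'I_n.+1) : {perm 'I_n.+1} :=
  if unlift z u is Some u' then
    (tperm (stack_pre u') z * lift_perm z z (trot T u'))%g
  else (tperm (l a) (l b) * tperm (l b) (l c))%g.

Let preP u v : reflect [\/ u = a /\ v = c, u = b /\ v = a | u = c /\ v = b]
  (stack_pre u == l v).
Proof.
rewrite /stack_pre; apply: (iffP eqP) => [|[] [-> ->]];
  rewrite ?eqxx ?nba ?nca ?ncb //.
case: eqP => [-> /lift_inj <-|_]; first by constructor.
case: eqP => [-> /lift_inj <-|_]; first by constructor.
case: eqP => [-> /lift_inj <-|_]; first by constructor.
by move/eqP; rewrite (negPf (neq_lift _ _)).
Qed.

Lemma stack_adjl u v : stack_adj (l u) (l v) = tadj T u v.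
Proof. by rewrite /stack_adj !liftK. Qed.

Lemma stack_adjz u : stack_adj z (l u) = corner u.
Proof. by rewrite /stack_adj unlift_none liftK. Qed.

Lemma stack_adj_sym u v : stack_adj u v = stack_adj v u.
Proof. by rewrite /stack_adj; do 2 case: unlift => // ?; rewrite tadj_sym. Qed.

Lemma stack_rotl u v : stack_pre u != l v ->
  stack_rot (l u) (l v) = l (trot T u v).
Proof.
by move=> h; rewrite /stack_rot liftK permM tpermD ?neq_lift // lift_perm_lift.
Qed.

Lemma stack_rot_pre u : stack_rot (l u) (stack_pre u) = z.
Proof. by rewrite /stack_rot liftK permM tpermL lift_perm_id. Qed.

Lemma stack_rotlz u v : stack_pre u = l v -> stack_rot (l u) z = l (trot T u v).
Proof. by move=> h; rewrite /stack_rot liftK permM tpermR h lift_perm_lift. Qed.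

Lemma stack_rotz v : stack_rot z (l v) =
  l (if v == a then c else if v == b then a else if v == c then b else v).
Proof.
rewrite /stack_rot unlift_none permM.
case: eqP => [->|/eqP na]; first by rewrite !tpermL.
case: eqP => [->|/eqP nb].
  by rewrite tpermR tpermD // (inj_eq lift_inj) ?nba ?nca.
have -> : tperm (l a) (l b) (l v) = l v by rewrite tpermD // (inj_eq lift_inj) eq_sym.
case: eqP => [->|/eqP nc]; first by rewrite tpermR.
by rewrite tpermD // (inj_eq lift_inj) eq_sym.
Qed.

Let stack_rot_a : stack_rot (l a) z = l b.
Proof. by rewrite (@stack_rotlz _ c) ?(face_rot cab) // /stack_pre eqxx. Qed.
Let stack_rot_b : stack_rot (l b) z = l c.
Proof. by rewrite (@stack_rotlz _ a) ?(face_rot abc) // /stack_pre nba eqxx. Qed.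
Let stack_rot_c : stack_rot (l c) z = l a.
Proof. by rewrite (@stack_rotlz _ b) ?(face_rot bca) // /stack_pre nca ncb eqxx. Qed.

Let ab_z : stack_rot (l b) (l a) = z.
Proof. by rewrite -[RHS](stack_rot_pre b) /stack_pre nba eqxx. Qed.
Let bc_z : stack_rot (l c) (l b) = z.
Proof. by rewrite -[RHS](stack_rot_pre c) /stack_pre nca ncb eqxx. Qed.
Let ca_z : stack_rot (l a) (l c) = z.
Proof. by rewrite -[RHS](stack_rot_pre a) /stack_pre eqxx. Qed.

Lemma stack_adj_irr u : ~~ stack_adj u u.
Proof. by rewrite /stack_adj; case: unlift => // v; rewrite tadj_irr. Qed.

Lemma stack_rot_out u v : ~~ stack_adj u v -> stack_rot u v = v.
Proof.
case: (unliftP z u) => [u'|] ->; case: (unliftP z v) => [v'|] ->.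
- rewrite stack_adjl => nuv; rewrite stack_rotl ?trot_out //.
  apply: contraNN nuv => /preP[] [-> ->]; rewrite tadj_sym.
  + exact: face_adj cab.
  + exact: face_adj abc.
  + exact: face_adj bca.
- rewrite stack_adj_sym stack_adjz => nu.
  have e : stack_pre u' = z.
    by move: nu; rewrite /corner /stack_pre; do 3 case: eqP => //.
  by have := stack_rot_pre u'; rewrite e.
- rewrite stack_adjz => nu; rewrite stack_rotz; congr (l _).
  by move: nu; rewrite /corner; do 3 case: eqP => //.
- by move=> _; rewrite /stack_rot unlift_none permM !tpermD // eq_sym neq_lift.
Qed.

(** At an old vertex, one step of the old rotation becomes one or two steps of the new one, so its
    cycle stays connected and the inserted vertex joins it. *)
Lemma stack_rot_cyc u v w :
  stack_adj u v -> stack_adj u w -> fconnect (stack_rot u) v w.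
Proof.
have symf x y z' : fconnect (stack_rot x) y z' = fconnect (stack_rot x) z' y.
  exact: fconnect_sym (@perm_inj _ _) _ _.
case: (unliftP z u) => [u'|] ->; last first.
  suff h x : stack_adj z x -> fconnect (stack_rot z) (l a) x.
    by move=> /h hv /h hw; apply: connect_trans hw; rewrite symf.
  case: (unliftP z x) => [x'|] ->; last by rewrite (negPf (stack_adj_irr _)).
  rewrite stack_adjz => /cornerP[] ->.
  - exact: connect0.
  - rewrite symf; apply: connect1 => /=.
    by rewrite stack_rotz nba eqxx.
  - apply: connect1 => /=.
    by rewrite stack_rotz eqxx.
have step x : fconnect (stack_rot (l u')) (l x) (l (trot T u' x)).
  case: (boolP (stack_pre u' == l x)) => [/eqP e|ne]; last first.
    by apply: connect1; rewrite /= stack_rotl.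
  apply: (@connect_trans _ _ z); apply: connect1 => /=.
    by rewrite -e stack_rot_pre.
  by rewrite (stack_rotlz e).
have steps x i : fconnect (stack_rot (l u')) (l x) (l (iter i (trot T u') x)).
  by elim: i => [|i IH]; [exact: connect0 | apply: connect_trans IH (step _)].
have lifted x y : tadj T u' x -> tadj T u' y ->
    fconnect (stack_rot (l u')) (l x) (l y).
  by move=> ux uy; rewrite -(iter_findex (trot_cyc ux uy)).
have new y : corner u' -> tadj T u' y -> fconnect (stack_rot (l u')) z (l y).
  move=> cu uy; apply: (connect_trans (fconnect1 _ _)).
  suff [x e ux] : exists2 x, stack_rot (l u') z = l x & tadj T u' x.
    by rewrite e lifted.
  case/cornerP: cu => ->.
  - by exists b => //; apply: face_adj abc.
  - by exists c => //; apply: face_adj bca.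
  - by exists a => //; apply: face_adj cab.
case: (unliftP z v) => [v'|] ->; case: (unliftP z w) => [w'|] ->;
  rewrite ?(stack_adj_sym _ z) ?stack_adjz ?stack_adjl.
- exact: lifted.
- by move=> uv cu; rewrite symf new.
- exact: new.
- by move=> _ _; exact: connect0.
Qed.

Lemma stack_conn u v : connect stack_adj u v.
Proof.
have symc := sym_connect_sym stack_adj_sym.
have lifted x y : connect stack_adj (l x) (l y).
  case/connectP: (tconn T x y) => p; elim: p x => [|x' p IH] x /=.
    by move=> _ ->; rewrite connect0.
  case/andP=> xx' pp ey; apply: connect_trans (IH _ pp ey).
  by apply: connect1; rewrite stack_adjl.
have za : connect stack_adj z (l a).
  by apply: connect1; rewrite stack_adjz /corner eqxx.
suff h x : connect stack_adj (l a) x by apply: connect_trans (h v); rewrite symc.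
by case: (unliftP z x) => [x'|] ->; rewrite // symc.
Qed.

(** [stack_pre v = l u] holds exactly when the dart (u,v) bounds the face [a b c]. Such darts get
    the new vertex as third corner; the others keep their old triangle. *)
Lemma stack_faces3 u v : stack_adj u v -> stack_rot (stack_rot v u) v = u.
Proof.
case: (unliftP z v) => [v'|] ->; case: (unliftP z u) => [u'|] ->.
- rewrite stack_adjl => uv.
  case: (boolP (stack_pre v' == l u')) => [/preP|npre].
    case=> -[-> ->]; rewrite ?ca_z ?ab_z ?bc_z stack_rotz.
    + by rewrite eqxx.
    + by rewrite nba eqxx.
    + by rewrite nca ncb eqxx.
  have uvw : face T u' v' (trot T v' u') by rewrite /face uv eqxx.
  rewrite stack_rotl // stack_rotl ?tfaces3 //.
  have vwu := face_rotate uvw.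
  (* If the next dart of the triangle bounded [a b c], then so would (u',v'). *)
  apply: contraNN npre => /preP[] [ew ev].
  + by apply/preP; constructor 3; rewrite -(face_rot vwu) ew ev (face_rot cab).
  + by apply/preP; constructor 1; rewrite -(face_rot vwu) ew ev (face_rot abc).
  + by apply/preP; constructor 2; rewrite -(face_rot vwu) ew ev (face_rot bca).
- rewrite stack_adjz => /cornerP[] ->.
  + by rewrite stack_rot_a ab_z.
  + by rewrite stack_rot_b bc_z.
  + by rewrite stack_rot_c ca_z.
- rewrite stack_adj_sym stack_adjz => /cornerP[] ->; rewrite stack_rotz.
  + by rewrite eqxx stack_rot_c.
  + by rewrite nba eqxx stack_rot_a.
  + by rewrite nca ncb eqxx stack_rot_b.
- by rewrite (negPf (stack_adj_irr _)).
Qed.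

Lemma sum_corner : \sum_u corner u = 3.
Proof.
rewrite (bigD1 a) // (bigD1 b) ?nba // (bigD1 c) ?nca ?ncb //= /corner.
rewrite !eqxx !orbT big1 // => u /andP[/andP[/negPf-> /negPf->] /negPf->] //.
Qed.

Lemma stack_degl u : \sum_v stack_adj (l u) v = corner u + deg T u.
Proof.
rewrite big_ord_recl stack_adj_sym stack_adjz; congr addn.
by apply: eq_bigr => v _; rewrite stack_adjl.
Qed.

Lemma stack_degz : \sum_v stack_adj z v = 3.
Proof.
rewrite big_ord_recl (negPf (stack_adj_irr _)) -sum_corner; congr addn.
by apply: eq_bigr => v _; rewrite stack_adjz.
Qed.

(** Three corners gain one dart each and the new vertex has three: six more darts for one more
    vertex. *)
Lemma stack_euler : n.+1 + fcard (face_step stack_rot) (darts_of stack_adj)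
  = #|darts_of stack_adj| %/ 2 + 2.
Proof.
apply/(euler_card stack_adj_irr stack_rot_out stack_faces3 stack_adj_sym).
rewrite card_darts big_ord_recl stack_degz.
under eq_bigr do rewrite stack_degl.
by rewrite big_split /= sum_corner mulnS -(sum_deg T) !addnA.
Qed.

Definition stack := Triangulation stack_adj_irr stack_adj_sym stack_rot_out
  stack_rot_cyc stack_conn stack_faces3 stack_euler.

Lemma deg_stackl u : deg stack (l u) = [|| u == a, u == b | u == c] + deg T u.
Proof. exact: stack_degl. Qed.

Lemma deg_stackz : deg stack z = 3.
Proof. exact: stack_degz. Qed.

Lemma face_stack_ab : face stack (l a) (l b) z.
Proof. by rewrite /face /= ab_z stack_adjl (face_adj abc) eqxx. Qed.

Lemma face_stack_bc : face stack (l b) (l c) z.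
Proof. by rewrite /face /= bc_z stack_adjl (face_adj bca) eqxx. Qed.

Lemma face_stack_ca : face stack (l c) (l a) z.
Proof. by rewrite /face /= ca_z stack_adjl (face_adj cab) eqxx. Qed.

(** A face is determined by any of its darts, so avoiding the three darts of [a b c] means being
    another face. *)
Lemma face_stack u v w : face T u v w ->
  (u, v) \notin [:: (a, b); (b, c); (c, a)] -> face stack (l u) (l v) (l w).
Proof.
move=> uvw nuv; rewrite /face /= stack_adjl (face_adj uvw) /=.
rewrite stack_rotl ?(face_rot uvw) //; apply: contraNN nuv => /preP.
by case=> -[-> ->]; rewrite !inE eqxx ?orbT.
Qed.

End Stack.

(** * Vertex covers under stacking *)

Section Extend.

Variables (n : nat) (x : bool) (J : pred 'I_n).

Definition extend : pred 'I_n.+1 :=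
  fun u => if unlift ord0 u is Some u' then J u' else x.

Lemma extendl u : extend (lift ord0 u) = J u.
Proof. by rewrite /extend liftK. Qed.

Lemma extendz : extend ord0 = x.
Proof. by rewrite /extend unlift_none. Qed.

Lemma sum_extend : \sum_u extend u = x + \sum_u J u.
Proof.
rewrite big_ord_recl extendz; congr addn.
by apply: eq_bigr => u _; rewrite extendl.
Qed.

End Extend.

(** Equivalently, the vertices outside [J], here the stacked ones, are independent. *)
Definition covers n (T : triangulation n) (J : pred 'I_n) :=
  forall u v, tadj T u v -> J u || J v.

Lemma covers_stack n (T : triangulation n) a b c (abc : face T a b c) x J :
  covers T J -> x || [&& J a, J b & J c] -> covers (stack abc) (extend x J).
Proof.
move=> cov hx.
have new u : stack_adj T a b c ord0 (lift ord0 u) -> x || J u.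
  rewrite stack_adjz; case/orP: hx => [-> //|/and3P[ja jb jc]].
  by case/or3P=> /eqP->; rewrite ?ja ?jb ?jc orbT.
move=> u v /=; case: (unliftP ord0 u) => [u'|] ->;
  case: (unliftP ord0 v) => [v'|] ->; rewrite ?extendl ?extendz.
- by rewrite stack_adjl; apply: cov.
- by rewrite stack_adj_sym orbC; apply: new.
- exact: new.
- by rewrite (negPf (stack_adj_irr _ _ _ _ _)).
Qed.

(** * The triangle, starting point of both constructions *)

Lemma triangle_exists : exists T : triangulation 3, exists a b c : 'I_3,
  [/\ face T a b c, face T b a c, deg T =1 fun=> 2 & forall u, [|| u == a, u == b | u == c]].
Proof.
(* Modulo 3 this is -u-v: the third vertex if u and v differ, and v itself if they agree. *)
have third_inj (u : 'I_3) : injective (fun v : 'I_3 => inord ((6 - u - v) %% 3) : 'I_3).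
  move=> v w /(congr1 val) /=; rewrite !inordK ?ltn_pmod // => e.
  by apply: val_inj => /=; have := ltn_ord u; have := ltn_ord v; have := ltn_ord w; lia.
pose rot u := perm (@third_inj u).
pose adj : rel 'I_3 := fun u v => u != v.
have rotE u v : rot u v = (6 - u - v) %% 3 :> nat.
  by rewrite permE inordK ?ltn_pmod.
have irr u : ~~ adj u u by rewrite /adj eqxx.
have sym u v : adj u v = adj v u by rewrite /adj eq_sym.
have out u v : ~~ adj u v -> rot u v = v.
  rewrite /adj negbK => /eqP->; apply: val_inj; rewrite /= rotE.
  by have := ltn_ord v; lia.
have cyc u v w : adj u v -> adj u w -> fconnect (rot u) v w.
  rewrite /adj -!val_eqE /= => uv uw.
  case: (eqVneq v w) => [->|]; first exact: connect0.
  rewrite -val_eqE /= => vw; apply: connect1; rewrite /= -val_eqE /= rotE.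
  by have := ltn_ord u; have := ltn_ord v; have := ltn_ord w; lia.
have conn u v : connect adj u v.
  by case: (eqVneq u v) => [->|uv]; [exact: connect0 | exact: connect1].
have faces u v : adj u v -> rot (rot v u) v = u.
  rewrite /adj -!val_eqE /= => uv; apply: val_inj; rewrite /= !rotE.
  by have := ltn_ord u; have := ltn_ord v; lia.
have degE u : \sum_v adj u v = 2.
  by case: u => [[|[|[|u]]] hu] //; rewrite !big_ord_recl big_ord0.
have euler : 3 + fcard (face_step rot) (darts_of adj) = #|darts_of adj| %/ 2 + 2.
  apply/(euler_card irr out faces sym).
  by rewrite card_darts; under eq_bigr do rewrite degE; rewrite sum_nat_const card_ord.
exists (Triangulation irr sym out cyc conn faces euler).
exists (inord 0), (inord 1), (inord 2); split=> //.
- by rewrite /face /= /adj -!val_eqE /= rotE !inordK.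
- by rewrite /face /= /adj -!val_eqE /= rotE !inordK.
- move=> u; rewrite -!val_eqE /= !inordK //; have := ltn_ord u; lia.
Qed.

(** * The cube of a path with stacked faces *)

(* [J] is the set of path-cube vertices and [a b c] the face formed by the last
   three.  One step stacks the next one in [a b c] and fills the two new faces at
   [a], so a vertex has degree at most 5, 7, 9 as third, second, first corner of
   the last face, and 12 once it has left it. *)
Definition helix n m := exists (T : triangulation n) (J : pred 'I_n) (a b c : 'I_n),
  [/\ face T a b c, [&& J a, J b & J c], covers T J /\ \sum_u J u = m,
      [/\ deg T a <= 9, deg T b <= 7 & deg T c <= 5] & forall u, deg T u <= 12].

Lemma lift_eq n (h : 'I_n) (u v : 'I_n.-1) : (lift h u == lift h v) = (u == v).
Proof. exact: (inj_eq (@lift_inj _ h)). Qed.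

Lemma lift_eq0 n (u : 'I_n) : (lift ord0 u == ord0) = false.
Proof. by rewrite eq_sym (negPf (neq_lift _ _)). Qed.

Lemma eq0_lift n (u : 'I_n) : (ord0 == lift ord0 u) = false.
Proof. by rewrite eq_sym lift_eq0. Qed.

Lemma helix_step n m : helix n m -> helix n.+3 m.+1.
Proof.
case=> T [J] [a] [b] [c] [abc /and3P[Ja Jb Jc] [cov card] [da db dc] d12].
pose l n := @lift n.+1 ord0.
have nab := face_neq abc; have nbc := face_neq (face_rotate abc).
have nca := face_neq (face_rotate (face_rotate abc)).
(* With z stacked in [a b c], the faces [a b z] and [c a z] are filled in turn, and [b c z] survives
   as the next last face. *)
have fab := face_stack_ab abc.
have fca := face_stack fab (face_stack_ca abc).
have fbc := face_stack fab (face_stack_bc abc).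
move: fca fbc; rewrite !inE !xpair_eqE ?lift_eq ?lift_eq0 ?eq0_lift ?andbF ?orbF.
rewrite (eq_sym c b) (negPf nbc) (eq_sym b a) (negPf nab) (negPf nca) /=.
move=> /(_ isT) fca /(_ isT) fbc.
have := face_stack fca fbc.
rewrite !inE !xpair_eqE ?lift_eq ?lift_eq0 ?eq0_lift ?andbF ?orbF.
rewrite (negPf nbc) /=.
move=> /(_ isT) fend.
exists (stack fca), (extend false (extend false (extend true J))).
exists (l _ (l _ (l _ b))), (l _ (l _ (l _ c))), (l _ (l _ ord0)).
(* The summands record the three stackings: [a] gains 3, [b] and [c] gain 2 each. *)
have dl u : deg (stack fca) (l _ (l _ (l _ u))) =
    [|| u == c | u == a] + ([|| u == a | u == b] + ([|| u == a, u == b | u == c] + deg T u)).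
  by rewrite !deg_stackl !lift_eq !lift_eq0 !orbF.
have dz : deg (stack fca) (l _ (l _ ord0)) = 5.
  by rewrite !deg_stackl deg_stackz !lift_eq !eq0_lift eqxx !orbT.
split=> //.
- by rewrite !extendl extendz Jb Jc.
- split; last by rewrite !sum_extend card.
  apply: covers_stack; last by rewrite !extendl extendz Ja Jc.
  apply: covers_stack; last by rewrite !extendl extendz Ja Jb.
  exact: covers_stack.
- rewrite !dl dz !eqxx (eq_sym b a) (eq_sym c b) (negPf nab) (negPf nbc) (negPf nca) /=.
  by split=> //; lia.
- move=> u; case: (unliftP ord0 u) => [{}u|] ->; last by rewrite deg_stackz.
  case: (unliftP ord0 u) => [{}u|] ->; last first.
    by rewrite deg_stackl deg_stackz !eq0_lift.
  case: (unliftP ord0 u) => [{}u|] ->; last by rewrite dz.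
  rewrite dl; case: (eqVneq u a) => [->|ua].
    by rewrite (eq_sym a c) (negPf nca); lia.
  case: (eqVneq u b) => [->|ub]; first by rewrite (negPf nbc); lia.
  by case: (eqVneq u c) => [->|uc]; [lia | apply: d12].
Qed.

(** A step adds three vertices, so other residues need their own start: for 4 vertices, the back
    face of the triangle is filled. *)
Lemma helix_seeds : helix 3 3 /\ helix 4 3.
Proof.
have [T [a [b [c [abc bac d2 _]]]]] := triangle_exists; split.
  exists T, xpredT, a, b, c; split=> //; rewrite ?d2 //; last by move=> u; rewrite d2.
  by split=> //; rewrite sum_nat_const card_ord.
have nab := face_neq abc; have nbc := face_neq (face_rotate abc).
have nca := face_neq (face_rotate (face_rotate abc)).
have := face_stack bac abc.
rewrite !inE !xpair_eqE (negPf nab) (negPf nbc) (eq_sym a c) (negPf nca) andbF.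
move=> /(_ isT) f.
have d3 u : deg (stack bac) u <= 3.
  case: (unliftP ord0 u) => [{}u|] ->; last by rewrite deg_stackz.
  by rewrite deg_stackl d2; case: (_ || _).
have le3 k u : 3 <= k -> deg (stack bac) u <= k by apply: leq_trans.
exists (stack bac), (extend false xpredT).
exists (lift ord0 a), (lift ord0 b), (lift ord0 c).
split; [exact: f | by rewrite !extendl | | by split; apply: le3 | by move=> u; apply: le3].
by split; [exact: covers_stack | rewrite sum_extend sum_nat_const card_ord].
Qed.

Lemma helix_steps t n m : helix n m -> helix (3 * t + n) (t + m).
Proof.
move=> h; elim: t => // t IH.
by rewrite mulnS -addnA addSn; apply: helix_step.
Qed.

Lemma sparse_exists n : 3 <= n -> exists (T : triangulation n) (J : pred 'I_n),
  [/\ covers T J, 3 * \sum_u J u <= n + 6 & forall u, deg T u <= 12].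
Proof.
have weaken k m : helix k m -> 3 * m <= k + 6 ->
    exists (T : triangulation k) (J : pred 'I_k),
      [/\ covers T J, 3 * \sum_u J u <= k + 6 & forall u, deg T u <= 12].
  by case=> T [J] [a] [b] [c] [_ _ [cov card] _ d12] le; exists T, J; rewrite card.
have [h33 h43] := helix_seeds.
move=> n3; pose t := n %/ 3 - 1.
have := divn_eq n 3; have := ltn_pmod n (isT : 0 < 3).
case: (n %% 3) => [|[|[|//]]] _ e.
- have -> : n = 3 * t + 3 by rewrite /t; lia.
  by apply: weaken (helix_steps t h33) _; lia.
- have -> : n = 3 * t + 4 by rewrite /t; lia.
  by apply: weaken (helix_steps t h43) _; lia.
(* For the last residue one more vertex is stacked in the last face, whose corners have degree at
   most 9. *)
- have -> : n = (3 * t + 4).+1 by rewrite /t; lia.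
  have [T [J [a [b [c [abc Jabc [cov card] [da db dc] d12]]]]]] := helix_steps t h43.
  exists (stack abc), (extend false J); split.
  + exact: covers_stack.
  + by rewrite sum_extend card; lia.
  move=> u; case: (unliftP ord0 u) => [{}u|] ->; last by rewrite deg_stackz.
  rewrite deg_stackl; case: (eqVneq u a) => [->|_]; first by rewrite /=; lia.
  case: (eqVneq u b) => [->|_]; first by rewrite /=; lia.
  by case: (eqVneq u c) => [->|_]; [rewrite /=; lia | apply: d12].
Qed.

(** * The double fan *)

Definition outer n (T : triangulation n) x y u v :=
  [&& tadj T u v, u != x, u != y, v != x & v != y].

(** The path left after deleting [x] and [y] is recorded only through its degrees; [p] is the end at
    which it grows. *)
Definition double_fan n := exists (T : triangulation n) (x y p : 'I_n),
  [/\ face T x y p, \sum_v outer T x y p v <= 1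
    & forall u, \sum_v outer T x y u v <= 2].

Lemma sum_eq1 (I : finType) (x : I) (F : I -> nat) : \sum_u (u == x) * F u = F x.
Proof.
rewrite (bigD1 x) //= eqxx mul1n big1 ?addn0 // => u /negPf->.
by rewrite mul0n.
Qed.

(** Stacking in [x y p] adds to the path only the edge from [p] to the new vertex, which becomes the
    end. *)
Lemma double_fan_step n : double_fan n -> double_fan n.+1.
Proof.
case=> T [x] [y] [p] [xyp dp d2].
exists (stack xyp), (lift ord0 x), (lift ord0 y), ord0.
have out_new u : outer (stack xyp) (lift ord0 x) (lift ord0 y) ord0 (lift ord0 u)
    <= (u == p).
  rewrite /outer /= stack_adjz !lift_eq.
  by case: (u == x); case: (u == y); case: (u == p).
have out_sym u : outer (stack xyp) (lift ord0 x) (lift ord0 y) (lift ord0 u) ord0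
    <= (u == p).
  rewrite /outer /= stack_adj_sym stack_adjz !lift_eq.
  by case: (u == x); case: (u == y); case: (u == p) => //=; rewrite leq_b1.
have dz : \sum_v outer (stack xyp) (lift ord0 x) (lift ord0 y) ord0 v <= 1.
  rewrite big_ord_recl /outer /= (negPf (stack_adj_irr _ _ _ _ _)) add0n.
  rewrite -(sum_eq1 p (fun=> 1)); apply: leq_sum => u _; rewrite muln1.
  exact: out_new.
split=> //; first exact: face_stack_ab.
move=> u; case: (unliftP ord0 u) => [{}u|] ->; last exact: leq_trans dz _.
rewrite big_ord_recl.
have -> : \sum_(i < n) outer (stack xyp) (lift ord0 x) (lift ord0 y) (lift ord0 u) (lift ord0 i)
        = \sum_v outer T x y u v.
  by apply: eq_bigr => v _; rewrite /outer /= stack_adjl !lift_eq.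
have := out_sym u; case: (eqVneq u p) => [->|_] h.
  by apply: (leq_add h dp).
by apply: (leq_add h (d2 u)).
Qed.

Lemma double_fan_exists n : 3 <= n -> double_fan n.
Proof.
move=> n3; rewrite -(subnK n3); elim: (n - 3) => [|k IH]; last exact: double_fan_step.
have [T [a [b [c [abc _ d2 all3]]]]] := triangle_exists.
exists T, a, b, c; split=> //; last first.
  move=> u; apply: leq_trans (eq_leq (d2 u)); apply: leq_sum => v _.
  by rewrite /outer; case: tadj => //=; rewrite leq_b1.
rewrite big1 // => v _; rewrite /outer.
by case/or3P: (all3 v) => /eqP->; rewrite ?eqxx ?andbF // (negPf (tadj_irr _ _)).
Qed.

(** * Flips against missing edges, and the bound *)

(** The sum counts darts, so each flip adds at most 2: the two directions of the removed edge. The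
    isomorphisms along the walk compose to [f]. *)
Lemma flip_walk_missing n k (G H : triangulation n) : flip_walk k G H ->
  exists f : {perm 'I_n},
    \sum_u \sum_v (tadj G u v && ~~ tadj H (f u) (f v)) <= 2 * k.
Proof.
elim: k H => [|k IH] H /=.
  case=> f iso; exists f; rewrite big1 // => u _; rewrite big1 // => v _.
  by have [-> _] := iso u v; rewrite andbN.
case=> G' [/IH[f le]] [a] [b] [H'] [[_ _ _ adjH' _] [g iso]].
exists (f * g)%g.
have pick (s t : 'I_n) : \sum_u \sum_v (u == s) * (v == t) = 1.
  rewrite -[RHS](sum_eq1 s (fun=> 1)); apply: eq_bigr => u _.
  by rewrite -big_distrr /= -(sum_eq1 t (fun=> 1)); under [in RHS]eq_bigr do rewrite muln1.
(* The removed edge, pulled back to the vertices of [G]. *)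
pose a' := (f^-1)%g a; pose b' := (f^-1)%g b.
apply: (@leq_trans (2 * k + 1 + 1)); last by lia.
rewrite -[X in _ + X](pick b' a') -[X in _ + X + _](pick a' b').
apply: (@leq_trans (\sum_u \sum_v ((tadj G u v && ~~ tadj G' (f u) (f v))
    + (u == a') * (v == b') + (u == b') * (v == a')))); last first.
  under eq_bigr do rewrite !big_split.
  by rewrite !big_split /= !leq_add2r.
apply: leq_sum => u _; apply: leq_sum => v _; rewrite !permM.
have [-> _] := iso (f u) (f v); rewrite adjH' /a' /b'.
rewrite -!(can2_eq (permK f) (permKV f)).
case: (tadj G u v); case: (tadj G' _ _) => //=;
  last by rewrite -addnA (leq_trans (leq_b1 _)) ?leq_addr.
by case: (f u == a); case: (f u == b); case: (f v == a); case: (f v == b);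
  rewrite //=; case: (_ || _).
Qed.

(** A dart of [G] is missing in [H], or has an end sent to [x] or [y] (at most 4 * 12 darts), or is
    sent to an outer dart and has an end in [J] (at most 2 per element of [J] and direction). The 60
    is 48 plus the 12 of [sum_deg]. *)
Lemma missing_edges_ge n (G H : triangulation n) (f : {perm 'I_n}) J x y :
  covers G J -> (forall u, deg G u <= 12) ->
  (forall u, \sum_v outer H x y u v <= 2) ->
  6 * n <= \sum_u \sum_v (tadj G u v && ~~ tadj H (f u) (f v))
           + 4 * \sum_u J u + 60.
Proof.
move=> cov d12 d2; rewrite -(sum_deg G).
pose x' := (f^-1)%g x; pose y' := (f^-1)%g y.
pose o u v : nat := outer H x y (f u) (f v).
have o2 u : \sum_v o u v <= 2.
  apply: leq_trans (d2 (f u)).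
  by rewrite [leqRHS](reindex_inj (@perm_inj _ f)).
have oC u v : o u v = o v u.
  by rewrite /o /outer tadj_sym; do 4 case: (_ != _); rewrite ?andbF.
have row s : \sum_u \sum_v (u == s) * tadj G u v <= 12.
  by under eq_bigr do rewrite -big_distrr /=; rewrite sum_eq1; apply: d12.
have col s : \sum_u \sum_v (v == s) * tadj G u v <= 12.
  apply: leq_trans (d12 s); apply: leq_sum => u _.
  by rewrite sum_eq1 tadj_sym.
have rowJ : \sum_u \sum_v J u * o u v <= 2 * \sum_u J u.
  rewrite big_distrr /=; apply: leq_sum => u _.
  by rewrite -big_distrr /= mulnC leq_mul2r o2 orbT.
have colJ : \sum_u \sum_v J v * o u v <= 2 * \sum_u J u.
  rewrite exchange_big /=; apply: leq_trans rowJ.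
  by apply: leq_sum => u _; apply: leq_sum => v _; rewrite oC.
apply: (@leq_trans (\sum_u \sum_v ((tadj G u v && ~~ tadj H (f u) (f v))
    + (u == x') * tadj G u v + (u == y') * tadj G u v
    + (v == x') * tadj G u v + (v == y') * tadj G u v
    + J u * o u v + J v * o u v) + 12)).
  rewrite leq_add2r; apply: leq_sum => u _; apply: leq_sum => v _.
  rewrite /o /outer -!(can2_eq (permK f) (permKV f)).
  have := cov u v; case: (tadj G u v) => // /(_ isT).
  case: (tadj H _ _) => //=.
  by do 4 case: (_ == _) => //=; case: (J u); case: (J v).
under eq_bigr do rewrite !big_split.
rewrite !big_split /=.
set m := \sum_u J u in rowJ colJ *; set missing := \sum_u \sum_v (_ && _).
apply: (@leq_trans (missing + 12 + 12 + 12 + 12 + 2 * m + 2 * m + 12)); last by lia.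
by rewrite leq_add2r; do 6 apply: leq_add => //.
Qed.

(* diam(G_n) >= 7n/3 - 34, i.e. some pair of triangulations at flip distance
   k with 3k >= 7n - 102 (k integer). *)
Theorem theorem1 (n : nat) : 3 <= n ->
  exists G H : triangulation n,
    forall k : nat, flip_walk k G H -> 7 * n <= 3 * k + 102.
Proof.
move=> n3.
have [G [J [cov cardJ d12]]] := sparse_exists n3.
have [H [x [y [p [_ _ d2]]]]] := double_fan_exists n3.
exists G, H => k /flip_walk_missing[f le].
(* With m the size of [J], 6n <= 2k + 4m + 60 and 3m <= n + 6 give 14n <= 6k + 204. *)
have := missing_edges_ge f cov d12 d2; lia.
Qed.
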